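(* Assume that $S_1$, $S_2$ and $S_3$ are all invertible, and that $A_2=0$ and $A_3=0$. Let $$\mathcal{P}_{D_1}=\begin{bmatrix} A_1&0&0\\0&S_2&0\\0&0&S_3\end{bmatrix}.$$ Then $$\mathcal{T}_1:=\mathcal{P}_{D_1}^{-1}\mathcal{A}=\begin{bmatrix} I & A_1^{-1}B_1^T & 0\\ S_2^{-1}C_1 & 0 & S_2^{-1}B_2^T\\ 0 & S_3^{-1}C_2 & 0\end{bmatrix},$$ and $\mathcal{T}_1$ satisfies the polynomial equation $(\lambda-1)(\lambda^2-\lambda-1)(\lambda^3-\lambda^2-2\lambda+1)=0$, i.e. $$(\mathcal{T}_1-I)(\mathcal{T}_1^2-\mathcal{T}_1-I)(\mathcal{T}_1^3-\mathcal{T}_1^2-2\mathcal{T}_1+I)=0.$$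
   Context: Let $n_1,n_2,n_3\ge 1$. $A_i$ is a real $n_i\times n_i$ matrix ($i=1,2,3$), $B_1,C_1$ are real $n_2\times n_1$ matrices, and $B_2,C_2$ are real $n_3\times n_2$ matrices. No symmetry or definiteness is assumed. The twofold saddle point matrix is $$\mathcal{A}=\begin{bmatrix} A_1 & B_1^T & 0\\ C_1 & -A_2 & B_2^T\\ 0 & C_2 & A_3\end{bmatrix}.$$ The nested Schur complements are defined by $S_1=A_1$, $S_2=A_2+C_1S_1^{-1}B_1^T$, $S_3=A_3+C_2S_2^{-1}B_2^T$ (each defined when the preceding one is invertible). $I$ denotes identity matrices of the appropriate sizes. *)

(* Defs.v *)
From mathcomp Require Import all_boot all_order all_algebra.
From mathcomp Require Import reals.

Set Implicit Arguments.
Unset Strict Implicit.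
Unset Printing Implicit Defensive.

Import GRing.Theory.
Local Open Scope ring_scope.

Definition block3_mx (R : nmodType) (n1 n2 n3 : nat)
    (M11 : 'M[R]_n1) (M12 : 'M[R]_(n1, n2)) (M13 : 'M[R]_(n1, n3))
    (M21 : 'M[R]_(n2, n1)) (M22 : 'M[R]_n2) (M23 : 'M[R]_(n2, n3))
    (M31 : 'M[R]_(n3, n1)) (M32 : 'M[R]_(n3, n2)) (M33 : 'M[R]_n3) :
    'M[R]_(n1 + (n2 + n3)) :=
  block_mx M11 (row_mx M12 M13)
           (col_mx M21 M31) (block_mx M22 M23 M32 M33).

Section TwofoldSaddlePoint.

Variables (R : realType) (n1 n2 n3 : nat).
Variables (A1 : 'M[R]_n1) (A2 : 'M[R]_n2) (A3 : 'M[R]_n3).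
Variables (B1 C1 : 'M[R]_(n2, n1)) (B2 C2 : 'M[R]_(n3, n2)).

Definition saddle_mx : 'M[R]_(n1 + (n2 + n3)) :=
  block3_mx A1 B1^T     0
            C1 (- A2)   B2^T
            0  C2       A3.

(* As invmx M = M for a singular M, schur2 is meaningful only when schur1 is
   invertible, and schur3 only when schur1 and schur2 are. *)
Definition schur1 : 'M[R]_n1 := A1.

Definition schur2 : 'M[R]_n2 := A2 + C1 *m invmx schur1 *m B1^T.

Definition schur3 : 'M[R]_n3 := A3 + C2 *m invmx schur2 *m B2^T.

Definition precond_D1 : 'M[R]_(n1 + (n2 + n3)) :=
  block3_mx A1 0      0
            0  schur2 0
            0  0      schur3.

Definition precond_saddle_mx : 'M[R]_(n1 + (n2 + n3)) :=
  invmx precond_D1 *m saddle_mx.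

End TwofoldSaddlePoint.

(* Main.v *)
Require Import Defs.
From mathcomp Require Import all_boot all_order all_algebra.
From mathcomp Require Import reals.

Set Implicit Arguments.
Unset Strict Implicit.
Unset Printing Implicit Defensive.

Import GRing.Theory.
Local Open Scope ring_scope.

(** The blocks of [T] satisfy [Y X = 1] and [W Z = 1], where
    [X = A1^-1 B1^T], [Y = S2^-1 C1], [Z = S2^-1 B2^T] and [W = S3^-1 C2]: this
    is the definition of [S2] and [S3] once [A2 = A3 = 0].  So [X Y] and [Z W]
    are idempotents, and the product of the quadratic and the cubic factor at
    [T] collapses to [diag (1 - X Y, 0, 0)], the projection onto [ker Y].  There
    [T] acts as the identity, so [T - 1] kills it. *)

Section Block3.

Variables (R : pzRingType) (n1 n2 n3 : nat).

Lemma block3_mx_eq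
    (M11 N11 : 'M[R]_n1) (M12 N12 : 'M[R]_(n1, n2)) (M13 N13 : 'M[R]_(n1, n3))
    (M21 N21 : 'M[R]_(n2, n1)) (M22 N22 : 'M[R]_n2) (M23 N23 : 'M[R]_(n2, n3))
    (M31 N31 : 'M[R]_(n3, n1)) (M32 N32 : 'M[R]_(n3, n2)) (M33 N33 : 'M[R]_n3) :
    M11 = N11 -> M12 = N12 -> M13 = N13 ->
    M21 = N21 -> M22 = N22 -> M23 = N23 ->
    M31 = N31 -> M32 = N32 -> M33 = N33 ->
  block3_mx M11 M12 M13 M21 M22 M23 M31 M32 M33 =
  block3_mx N11 N12 N13 N21 N22 N23 N31 N32 N33.
Proof. by do 9![move=> ->]. Qed.

Lemma mul_block3_mx
    (M11 N11 : 'M[R]_n1) (M12 N12 : 'M[R]_(n1, n2)) (M13 N13 : 'M[R]_(n1, n3))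
    (M21 N21 : 'M[R]_(n2, n1)) (M22 N22 : 'M[R]_n2) (M23 N23 : 'M[R]_(n2, n3))
    (M31 N31 : 'M[R]_(n3, n1)) (M32 N32 : 'M[R]_(n3, n2)) (M33 N33 : 'M[R]_n3) :
  block3_mx M11 M12 M13 M21 M22 M23 M31 M32 M33
    *m block3_mx N11 N12 N13 N21 N22 N23 N31 N32 N33 =
  block3_mx
    (M11 *m N11 + (M12 *m N21 + M13 *m N31))
    (M11 *m N12 + (M12 *m N22 + M13 *m N32))
    (M11 *m N13 + (M12 *m N23 + M13 *m N33))
    (M21 *m N11 + (M22 *m N21 + M23 *m N31))
    (M21 *m N12 + (M22 *m N22 + M23 *m N32))
    (M21 *m N13 + (M22 *m N23 + M23 *m N33))
    (M31 *m N11 + (M32 *m N21 + M33 *m N31))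
    (M31 *m N12 + (M32 *m N22 + M33 *m N32))
    (M31 *m N13 + (M32 *m N23 + M33 *m N33)).
Proof.
(* The outer 2x2 product is expanded first, then the inner products of rows, columns and 2x2 blocks;
   the resulting sums merge block by block. *)
rewrite /block3_mx mulmx_block mul_row_col mul_row_block mul_mx_row.
rewrite mul_block_col mul_col_mx mulmx_block mul_col_row.
by rewrite add_row_mx add_col_mx add_block_mx.
Qed.

Lemma add_block3_mx
    (M11 N11 : 'M[R]_n1) (M12 N12 : 'M[R]_(n1, n2)) (M13 N13 : 'M[R]_(n1, n3))
    (M21 N21 : 'M[R]_(n2, n1)) (M22 N22 : 'M[R]_n2) (M23 N23 : 'M[R]_(n2, n3))
    (M31 N31 : 'M[R]_(n3, n1)) (M32 N32 : 'M[R]_(n3, n2)) (M33 N33 : 'M[R]_n3) :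
  block3_mx M11 M12 M13 M21 M22 M23 M31 M32 M33
    + block3_mx N11 N12 N13 N21 N22 N23 N31 N32 N33 =
  block3_mx (M11 + N11) (M12 + N12) (M13 + N13)
            (M21 + N21) (M22 + N22) (M23 + N23)
            (M31 + N31) (M32 + N32) (M33 + N33).
Proof. by rewrite /block3_mx !(add_block_mx, add_row_mx, add_col_mx). Qed.

Lemma opp_block3_mx
    (M11 : 'M[R]_n1) (M12 : 'M[R]_(n1, n2)) (M13 : 'M[R]_(n1, n3))
    (M21 : 'M[R]_(n2, n1)) (M22 : 'M[R]_n2) (M23 : 'M[R]_(n2, n3))
    (M31 : 'M[R]_(n3, n1)) (M32 : 'M[R]_(n3, n2)) (M33 : 'M[R]_n3) :
  - block3_mx M11 M12 M13 M21 M22 M23 M31 M32 M33 =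
  block3_mx (- M11) (- M12) (- M13) (- M21) (- M22) (- M23)
            (- M31) (- M32) (- M33).
Proof. by rewrite /block3_mx !(opp_block_mx, opp_row_mx, opp_col_mx). Qed.

Lemma block3_mx0 :
  block3_mx 0 0 0 0 0 0 0 0 0 = 0 :> 'M[R]_(n1 + (n2 + n3)).
Proof. by rewrite /block3_mx row_mx0 col_mx0 !block_mx0. Qed.

Lemma block3_mx1 :
  block3_mx 1%:M 0 0 0 1%:M 0 0 0 1%:M = 1%:M :> 'M[R]_(n1 + (n2 + n3)).
Proof. by rewrite /block3_mx row_mx0 col_mx0 -!scalar_mx_block. Qed.

End Block3.

(** Once the zero borders are merged, the matrix is block triangular at both levels, so its
    determinant is the product of the three diagonal determinants. *)
Lemma block3_diag_mx_unit (R : comUnitRingType) (n1 n2 n3 : nat)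
    (D1 : 'M[R]_n1) (D2 : 'M[R]_n2) (D3 : 'M[R]_n3) :
  (block3_mx D1 0 0 0 D2 0 0 0 D3 \in unitmx) =
  [&& D1 \in unitmx, D2 \in unitmx & D3 \in unitmx].
Proof.
by rewrite /block3_mx row_mx0 col_mx0 !unitmxE !det_ublock !unitrM.
Qed.

Lemma mulmx_block3_diag (R : pzRingType) (n1 n2 n3 : nat)
    (D1 : 'M[R]_n1) (D2 : 'M[R]_n2) (D3 : 'M[R]_n3)
    (M11 : 'M[R]_n1) (M12 : 'M[R]_(n1, n2)) (M13 : 'M[R]_(n1, n3))
    (M21 : 'M[R]_(n2, n1)) (M22 : 'M[R]_n2) (M23 : 'M[R]_(n2, n3))
    (M31 : 'M[R]_(n3, n1)) (M32 : 'M[R]_(n3, n2)) (M33 : 'M[R]_n3) :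
  block3_mx D1 0 0 0 D2 0 0 0 D3
    *m block3_mx M11 M12 M13 M21 M22 M23 M31 M32 M33 =
  block3_mx (D1 *m M11) (D1 *m M12) (D1 *m M13)
            (D2 *m M21) (D2 *m M22) (D2 *m M23)
            (D3 *m M31) (D3 *m M32) (D3 *m M33).
Proof. by rewrite mul_block3_mx !mul0mx !addr0 !add0r. Qed.

Section AnnihilatingPolynomial.

Variables (R : pzRingType) (n1 n2 n3 : nat).
Variables (X : 'M[R]_(n1, n2)) (Y : 'M[R]_(n2, n1)).
Variables (Z : 'M[R]_(n2, n3)) (W : 'M[R]_(n3, n2)).
Hypotheses (YX1 : Y *m X = 1%:M) (WZ1 : W *m Z = 1%:M).

Let T := block3_mx 1%:M X 0 Y 0 Z 0 W 0.

(** Right-associated forms of [YX1] and [WZ1]: they contract [Y X] and [W Z] inside longer products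
    normalized by [-mulmxA]. *)
Let YXr m (M : 'M[R]_(n2, m)) : Y *m (X *m M) = M.
Proof. by rewrite mulmxA YX1 mul1mx. Qed.

Let WZr m (M : 'M[R]_(n3, m)) : W *m (Z *m M) = M.
Proof. by rewrite mulmxA WZ1 mul1mx. Qed.

Local Notation mx_simp := (mul0mx, mulmx0, mul1mx, mulmx1, add0r, addr0, oppr0,
  mulmxDl, mulmxDr, mulNmx, mulmxN, opprK, opprD) (only parsing).

Let T_sqr : T ^+ 2 =
  block3_mx (1%:M + X *m Y) X             (X *m Z)
            Y               (1%:M + Z *m W) 0
            (W *m Y)        0             1%:M.
Proof.
(* The pattern [[LHS]] lets the ring product [T * T] match [*m] up to conversion. *)
by rewrite expr2 [LHS]mul_block3_mx !mx_simp YX1 WZ1.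
Qed.

Let T_quadratic : T ^+ 2 - T - 1%:M =
  block3_mx (X *m Y - 1%:M) 0        (X *m Z)
            0               (Z *m W) (- Z)
            (W *m Y)        (- W)    0.
Proof.
rewrite T_sqr -block3_mx1 !opp_block3_mx !add_block3_mx.
by apply: block3_mx_eq;
  rewrite ?oppr0 ?addr0 ?add0r ?subrr // [1%:M + _]addrC addrK.
Qed.

Let T_cubic : T ^+ 3 - T ^+ 2 - T *+ 2 + 1%:M =
  block3_mx (X *m Y - 1%:M)      (X *m (Z *m W) - X) 0
            (Z *m (W *m Y) - Y)  (1%:M - Z *m W)     0
            0                    0                   0.
Proof.
(* Dividing the cubic by the quadratic leaves the remainder [-(T - 1)]; thus one block product with
   the known quadratic suffices, without expanding [T ^+ 3]. *)
have -> : T ^+ 3 - T ^+ 2 - T *+ 2 + 1%:M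
          = T *m (T ^+ 2 - T - 1%:M) - (T - 1%:M).
  by rewrite !mulmxBr mulmx1 exprS expr2 mulr2n !opprD !opprK !addrA.
rewrite T_quadratic -block3_mx1 mul_block3_mx !opp_block3_mx !add_block3_mx.
rewrite opp_block3_mx add_block3_mx.
by apply: block3_mx_eq; rewrite !mx_simp -?mulmxA ?YX1 ?WZ1 ?YXr ?WZr;
  rewrite ?subrr ?addNr ?addr0 ?add0r // addrC.
Qed.

Lemma block3_annihilated :
  (T - 1%:M) *m (T ^+ 2 - T - 1%:M)
    *m (T ^+ 3 - T ^+ 2 - T *+ 2 + 1%:M) = 0.
Proof.
have MQ : (T ^+ 2 - T - 1%:M) *m (T ^+ 3 - T ^+ 2 - T *+ 2 + 1%:M)
          = block3_mx (1%:M - X *m Y) 0 0 0 0 0 0 0 0.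
  rewrite T_quadratic T_cubic mul_block3_mx.
  (* The first block is [(X Y - 1)^2 = 1 - X Y] by idempotence. In the rest of the first two block
     columns the terms cancel in pairs once [Y X] and [W Z] are contracted; the third block column
     is zero in the cubic factor. *)
  by apply: block3_mx_eq; rewrite !mx_simp -?mulmxA ?YX1 ?WZ1 ?YXr ?WZr;
    rewrite ?subrr ?add0r ?mulmx1 // 1?addrACA ?addNr ?subrr ?addr0 // addrC.
rewrite -mulmxA MQ -block3_mx1 opp_block3_mx add_block3_mx mul_block3_mx.
rewrite -[RHS]block3_mx0; apply: block3_mx_eq; rewrite !mx_simp ?subrr ?mul0mx //.
  by rewrite add0r addNr.
(* The remaining block is [Y (1 - X Y) = Y - (Y X) Y]. *)
by rewrite YXr subrr.
Qed.

End AnnihilatingPolynomial.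

Theorem theorem2p2 (R : realType) (n1 n2 n3 : nat)
  (n1_gt0 : (0 < n1)%N) (n2_gt0 : (0 < n2)%N) (n3_gt0 : (0 < n3)%N)
  (A1 : 'M[R]_n1) (A2 : 'M[R]_n2) (A3 : 'M[R]_n3)
  (B1 C1 : 'M[R]_(n2, n1)) (B2 C2 : 'M[R]_(n3, n2))
  (S1 := schur1 A1)
  (S2 := schur2 A1 A2 B1 C1)
  (S3 := schur3 A1 A2 A3 B1 C1 B2 C2)
  (P := precond_D1 A1 A2 A3 B1 C1 B2 C2)
  (T := precond_saddle_mx A1 A2 A3 B1 C1 B2 C2)
  (S1_unit : S1 \in unitmx) (S2_unit : S2 \in unitmx) (S3_unit : S3 \in unitmx)
  (A2_eq0 : A2 = 0) (A3_eq0 : A3 = 0) :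
  [/\ P \in unitmx,
      T = block3_mx 1%:M             (invmx A1 *m B1^T) 0
                    (invmx S2 *m C1) 0                  (invmx S2 *m B2^T)
                    0                (invmx S3 *m C2)   0
    & (T - 1%:M) *m (T ^+ 2 - T - 1%:M)
        *m (T ^+ 3 - T ^+ 2 - T *+ 2 + 1%:M) = 0].
Proof.
have Punit : P \in unitmx.
  by rewrite block3_diag_mx_unit; apply/and3P; split.
have TE : T = block3_mx 1%:M (invmx A1 *m B1^T) 0
    (invmx S2 *m C1) 0 (invmx S2 *m B2^T) 0 (invmx S3 *m C2) 0.
  (* Moving [P] to the other side reduces the claim to [saddle_mx] being [P] times the stated
     matrix, so the inverse of [P] is never computed. *)
  apply: (canLR (mulKmx Punit)); rewrite mulmx_block3_diag /saddle_mx.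
  by apply: block3_mx_eq;
    rewrite ?mulmx0 ?mulmx1 ?mulKVmx // ?A2_eq0 ?A3_eq0 ?oppr0.
(* These two factorizations turn [Y X] into [invmx S2 *m S2] and [W Z] into [invmx S3 *m S3]. *)
have S2E : S2 = C1 *m (invmx A1 *m B1^T).
  by rewrite /S2 /schur2 A2_eq0 add0r mulmxA.
have S3E : S3 = C2 *m (invmx S2 *m B2^T).
  by rewrite /S3 /schur3 A3_eq0 add0r mulmxA.
split=> //; rewrite TE; apply: block3_annihilated.
- by rewrite -mulmxA -S2E mulVmx.
- by rewrite -mulmxA -S3E mulVmx.
Qed.
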